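(* For every real $\delta>0$ there exists $k_0$ such that for every integer $k\ge k_0$, every tournament on at least $2(1+\delta)k^2$ vertices contains the $1$-subdivision $H_k$ of the transitive tournament $T_k$. (That is, every tournament on $2k^2(1+o(1))$ vertices contains the $1$-subdivision of $T_k$, where $o(1)\to 0$ as $k\to\infty$.)
   Context: A tournament is an orientation of a complete graph on a finite vertex set. $T_k$ is the transitive tournament on vertices $v_1,\ldots,v_k$, with edges $(v_i,v_j)$ (directed from $v_i$ to $v_j$) for all $1\le i<j\le k$. Its $1$-subdivision $H_k$ is the directed graph obtained from $T_k$ by replacing every edge $(v_i,v_j)$, $i<j$, with a directed path of length two through a new vertex: $H_k$ has the $k$ vertices $v_1,\ldots,v_k$ together with $\binom{k}{2}$ further distinct vertices $w_{i,j}$ ($1\le i<j\le k$), and its edges are exactly $(v_i,w_{i,j})$ and $(w_{i,j},v_j)$ for $1\le i<j\le k$. A directed graph $G$ contains a directed graph $H$ if $H$ is isomorphic to a (not necessarily induced) subgraph of $G$, i.e. there is an injective map $V(H)\to V(G)$ sending directed edges to directed edges. *)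

(* Defs.v *)
From mathcomp Require Import all_boot.

Set Implicit Arguments.
Unset Strict Implicit.
Unset Printing Implicit Defensive.

(* A finite directed graph is a relation [e : rel V] on [V : finType];
   [e x y] means that there is an edge directed from [x] to [y]. *)

Definition tournament (V : finType) (e : rel V) : Prop :=
  irreflexive e /\ forall x y : V, x != y -> e x y (+) e y x.

Definition transitive_tournament (k : nat) : rel 'I_k := fun i j => i < j.

(* The new vertex subdividing the edge [(x, y)] is the edge itself. *)
Definition subdiv_vertex (V : finType) (e : rel V) : finType :=
  (V + {p : V * V | e p.1 p.2})%type.

Definition subdiv_edge (V : finType) (e : rel V) : rel (subdiv_vertex e) :=
  fun a b => match a, b with
  | inl x, inr w => (val w).1 == x
  | inr w, inl y => (val w).2 == y
  | _, _ => false
  end.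

Arguments transitive_tournament : clear implicits.
Arguments subdiv_edge {V} e a b.

Definition contains (V W : finType) (eG : rel V) (eH : rel W) : Prop :=
  exists f : W -> V,
    injective f /\ forall x y : W, eH x y -> eG (f x) (f y).

(* Main.v *)
Require Import Defs.
From mathcomp Require Import all_boot all_order all_algebra reals.
From mathcomp Require Import ring lra zify.

Set Implicit Arguments.
Unset Strict Implicit.
Unset Printing Implicit Defensive.

Import Order.TTheory GRing.Theory Num.Theory.
Local Open Scope ring_scope.

(** Let [n] be the number of vertices, and let [D(x, y)] be the set of
    out-neighbours of [x] that are not out-neighbours of [y]. Apart from [y]
    itself, its elements are exactly the middle vertices of the paths of
    length two from [x] to [y]. If [x] has out-degree at least that of [y],
    then [D(x, y)] is the larger of [D(x, y)] and [D(y, x)]; so the branch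
    vertices are listed by decreasing out-degree, and the quantity that
    matters for a pair is the size of the larger of its two sets.

    Call two vertices [t]-near when both sets have fewer than [t] elements.
    The heart of the proof is [card_near]: every vertex is [t]-near to at
    most [4 t] vertices. Indeed, among the vertices near to [x] and beaten by
    [x], some vertex [y] beats at most half of the others; the rest lie in
    [D(x, y)], so there are at most [2 t] such vertices, and those that beat
    [x] are counted in the same way. Hence there are at most [2 t n] near
    pairs, and a random set of [k] vertices contains about
    [(k ^ 2 / n ^ 2) * 2 t n = 2 t k ^ 2 / n] of them, which is at most
    [t / (1 + delta)] when [n >= 2 (1 + delta) k ^ 2]. This is where the
    constant [2] comes from: for every [t], fewer than [t] of the pairs of
    branch vertices have less than [t] middle vertices at their disposal, and
    then middle vertices can be chosen greedily and distinct, serving the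
    pairs with few candidates first ([greedy_sdr]).

    To make this rigorous, the sample is a random map from [k + k / m] indices
    to vertices, with [m] a large constant. The number of near pairs in the
    sample is controlled by Chebyshev's inequality ([variance_pair_count]),
    simultaneously at all the levels [t = j ^ 4] between a constant fraction of
    [k] and [k ^ 2]. There are only about [sqrt k] such levels, each fails
    with probability of order [1 / k], and consecutive levels have a ratio
    close to [1]. Two defects are repaired by discarding at most [k / m]
    indices. Pairs that are near at the lowest level are too close to be used
    at all. And a set [D(x, y)] of size linear in [k] may lose
    too many elements to the sample itself, since a middle vertex must not be
    a branch vertex; the expected number of triples formed by a pair and a
    sampled vertex hitting its set is linear in [k] ([mean_hit_count]), so only
    boundedly many pairs are spoiled in this way. All these requirements are
    combined into a single average smaller than [1] ([exists_good_sample]), and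
    [contains_of_sample] turns a sample meeting them into the subdivision. *)

(** * Averages *)

Lemma sum_indicator (W : finType) (P : pred W) : (\sum_w P w)%N = #|P|.
Proof.
rewrite -sum1_card [RHS]big_mkcond; apply: eq_bigr => w _.
by rewrite unfold_in; case: (P w).
Qed.

Section Mean.
Variables (R : realFieldType) (W : finType).
Implicit Types F G : W -> R.

Definition mean F : R := (\sum_w F w) / #|W|%:R.

Lemma eq_mean F G : F =1 G -> mean F = mean G.
Proof. by move=> FG; rewrite /mean (eq_bigr G). Qed.

Lemma mean_cst (c : R) : (0 < #|W|)%N -> mean (fun=> c) = c.
Proof.
move=> W0; rewrite /mean sumr_const -(mulr_natr c) mulfK //.
by rewrite pnatr_eq0 -lt0n.
Qed.

Lemma meanD F G : mean (fun w => F w + G w) = mean F + mean G.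
Proof. by rewrite /mean big_split mulrDl. Qed.

Lemma meanZ (c : R) F : mean (fun w => c * F w) = c * mean F.
Proof. by rewrite /mean -mulr_sumr mulrA. Qed.

Lemma mean_sum (J : Type) (r : seq J) (P : pred J) (F : J -> W -> R) :
  mean (fun w => \sum_(j <- r | P j) F j w) = \sum_(j <- r | P j) mean (F j).
Proof. by rewrite /mean exchange_big mulr_suml. Qed.

Lemma ler_mean F G : (forall w, F w <= G w) -> mean F <= mean G.
Proof.
by move=> FG; rewrite /mean ler_wpM2r ?invr_ge0 ?ler0n // ler_sum.
Qed.

Lemma mean_ge0 F : (forall w, 0 <= F w) -> 0 <= mean F.
Proof. by move=> F0; rewrite divr_ge0 ?ler0n ?sumr_ge0. Qed.

Lemma exists_lt_mean F (c : R) : (0 < #|W|)%N -> mean F < c ->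
  exists w, F w < c.
Proof.
move=> W0 ltFc; apply/existsP; apply: contraLR ltFc.
rewrite negb_exists => /forallP cF; rewrite -leNgt.
by rewrite -[leLHS](mean_cst c W0); apply: ler_mean => w; rewrite leNgt cF.
Qed.

End Mean.

(** A union bound together with Markov's inequality: a sum of nonnegative
    penalties whose average is below [1] is below [1] at some point, and then
    so is each penalty. *)
Lemma exists_all_lt1 (R : realFieldType) (W J : finType) (P : pred J)
    (Y : W -> R) (Z : J -> W -> R) : (0 < #|W|)%N ->
  (forall w, 0 <= Y w) -> (forall j w, 0 <= Z j w) ->
  mean Y + \sum_(j | P j) mean (Z j) < 1 ->
  exists w, Y w < 1 /\ forall j, P j -> Z j w < 1.
Proof.
move=> W0 Y0 Z0; rewrite -mean_sum -meanD => /(exists_lt_mean W0)[w ltw].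
exists w; split=> [|j Pj]; apply: le_lt_trans ltw.
  by rewrite lerDl sumr_ge0.
by rewrite (bigD1 j) //= addrCA lerDl addr_ge0 // sumr_ge0.
Qed.

(** * Independent samples *)

Section Resample.
Variables (R : realFieldType) (I V : finType).
Hypothesis V0 : (0 < #|V|)%N.
Implicit Types (f : {ffun I -> V}) (F : {ffun I -> V} -> R) (G : V -> V -> R).

Definition resample f i x : {ffun I -> V} :=
  [ffun j => if j == i then x else f j].

Lemma resampleE f i x j : resample f i x j = if j == i then x else f j.
Proof. exact: ffunE. Qed.

Lemma card_samples_gt0 : (0 < #|{ffun I -> V}|)%N.
Proof. by rewrite card_ffun expn_gt0 V0. Qed.

(** Independence of the coordinates of a uniform random map: exchanging the
    value at [i] with an independent uniform one is an involution of the
    pairs formed by a map and a value, hence preserves averages. *)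
Lemma mean_resample i F :
  mean F = mean (fun f => mean (fun x => F (resample f i x))).
Proof.
rewrite /mean -mulr_suml; congr (_ / _).
pose h (p : {ffun I -> V} * V) := (resample p.1 i p.2, p.1 i).
have hK : involutive h.
  move=> [f x]; rewrite /h /= !resampleE eqxx; congr (_, _).
  by apply/ffunP => j; rewrite !resampleE; case: (j =P i) => // ->.
rewrite pair_big /= (reindex_inj (inv_inj hK)) /=.
under [X in _ = X / _]eq_bigr => p _.
  have -> : resample (resample p.1 i p.2) i (p.1 i) = p.1.
    by apply/ffunP => j; rewrite !resampleE; case: (j =P i) => // ->.
  over.
rewrite -(pair_big xpredT xpredT (fun f _ => F f)) /=.
under [X in _ = X / _]eq_bigr => f _ do rewrite sumr_const -(mulr_natr (F f)).
by rewrite -mulr_suml mulfK // pnatr_eq0 -lt0n.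
Qed.

Lemma mean_pair i j G : i != j ->
  mean (fun f => G (f i) (f j)) = mean (fun x => mean (fun y => G x y)).
Proof.
move=> ij; rewrite (mean_resample j).
under eq_mean => f do under eq_mean => x do rewrite !resampleE (negPf ij) eqxx.
rewrite (mean_resample i).
under eq_mean => f do under eq_mean => x do rewrite !resampleE eqxx.
by rewrite mean_cst // card_samples_gt0.
Qed.

End Resample.

Section Moments.
Variables (R : realFieldType) (I V : finType).
Hypothesis V0 : (0 < #|V|)%N.
Variables (near : rel V) (b : nat).
Hypothesis nearC : symmetric near.
Hypothesis near_b : forall x, (#|near x| <= b)%N.
Implicit Types (f : {ffun I -> V}).

Local Notation n := (#|V|%:R : R).

(** The probability that two independent uniform vertices are near. *)
Definition density : R := mean (fun x => mean (fun y => (near x y)%:R)).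

Definition npairs : R := #|[pred a : I * I | a.1 != a.2]|%:R.

Definition pair_count f : R :=
  \sum_(a : I * I | a.1 != a.2) (near (f a.1) (f a.2))%:R.

Lemma density_ge0 : 0 <= density.
Proof. by apply: mean_ge0 => x; apply: mean_ge0 => y; rewrite ler0n. Qed.

Lemma mean_near x : mean (fun y => (near x y)%:R) <= b%:R / n.
Proof.
rewrite /mean ler_wpM2r ?invr_ge0 ?ler0n // -natr_sum ler_nat.
by rewrite sum_indicator.
Qed.

Lemma density_le : density <= b%:R / n.
Proof.
apply: le_trans (ler_mean mean_near) _.
by rewrite mean_cst.
Qed.

Lemma npairs_le : npairs <= #|I|%:R ^+ 2.
Proof.
by rewrite -natrX ler_nat -mulnn -card_prod max_card.
Qed.

Lemma mean_near_pair i j : i != j ->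
  mean (fun f => (near (f i) (f j))%:R) = density.
Proof. by move=> ij; rewrite (mean_pair V0 (fun x y => (near x y)%:R)). Qed.

Lemma mean_pair_count : mean pair_count = npairs * density.
Proof.
rewrite mean_sum (eq_bigr (fun=> density)); last first.
  by move=> a /mean_near_pair.
by rewrite sumr_const mulr_natl.
Qed.

(** Averaging first over the value at [l], which occurs only once, uses the
    degree bound for the vertex [f k]. *)
Lemma mean_near_fresh i j k l : i != j -> l != i -> l != j -> l != k ->
  mean (fun f => (near (f i) (f j))%:R * (near (f k) (f l))%:R) <=
    density * (b%:R / n).
Proof.
move=> ij li lj lk; rewrite (mean_resample V0 l).
rewrite -(mean_near_pair ij) mulrC -meanZ.
apply: ler_mean => f.
under eq_mean => x do rewrite !resampleE ![_ == l]eq_sym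
  (negPf li) (negPf lj) (negPf lk) eqxx.
by rewrite meanZ mulrC ler_wpM2r ?ler0n // mean_near.
Qed.

Lemma mean_near_disjoint i j k l : i != j -> k != l ->
    k != i -> k != j -> l != i -> l != j ->
  mean (fun f => (near (f i) (f j))%:R * (near (f k) (f l))%:R) =
    density * density.
Proof.
move=> ij kl ki kj li lj; rewrite (mean_resample V0 l).
under eq_mean => f do under eq_mean => x do rewrite !resampleE ![_ == l]eq_sym
  (negPf li) (negPf lj) ![l == k]eq_sym (negPf kl) eqxx.
rewrite (mean_resample V0 k).
under eq_mean => f.
  under eq_mean => y.
    under eq_mean => x do rewrite !resampleE ![_ == k]eq_sym
      (negPf ki) (negPf kj) eqxx.
    rewrite meanZ. over.
  rewrite meanZ -/density mulrC. over.
by rewrite meanZ mean_near_pair.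
Qed.

(** The correlation of two index pairs in one formula: they are
    independent when disjoint; sharing one index adds at most
    [density * b / n], and sharing both at most [density]. *)
Lemma mean_near2 (a c : I * I) : a.1 != a.2 -> c.1 != c.2 ->
  mean (fun f => (near (f a.1) (f a.2))%:R * (near (f c.1) (f c.2))%:R) <=
    density * density + density * ((pred2 a.1 a.2 c.1 && pred2 a.1 a.2 c.2)%:R
      + b%:R / n * ((pred2 a.1 a.2 c.1)%:R + (pred2 a.1 a.2 c.2)%:R)).
Proof.
case: a c => i j [k l] /= ij kl.
have q0 := density_ge0.
have qq0 : 0 <= density * density by rewrite mulr_ge0.
have bn0 : 0 <= b%:R / n by rewrite divr_ge0 ?ler0n.
have qb0 : 0 <= density * (b%:R / n) by rewrite mulr_ge0.
case: (boolP ((k == i) || (k == j))) => kij;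
  case: (boolP ((l == i) || (l == j))) => lij /=.
- apply: (@le_trans _ _ density); last by nra.
  rewrite -(mean_near_pair ij); apply: ler_mean => f.
  by rewrite ler_piMr ?ler0n // lern1 leq_b1.
- move: lij; rewrite negb_or => /andP[li lj].
  by apply: le_trans (mean_near_fresh ij li lj _) _; rewrite 1?eq_sym //; nra.
- move: kij; rewrite negb_or => /andP[ki kj].
  apply: (@le_trans _ _ (density * (b%:R / n))); last by nra.
  have := mean_near_fresh ij ki kj kl.
  by under [X in X <= _ -> _]eq_mean => f do rewrite [near (f l) _]nearC.
- move: kij lij; rewrite !negb_or => /andP[ki kj] /andP[li lj].
  by rewrite (mean_near_disjoint ij kl ki kj li lj); nra.
Qed.

Lemma count_overlap (i j : I) :
  \sum_(c : I * I) (pred2 i j c.1)%:R <= 2 * #|I|%:R :> R.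
Proof.
rewrite -(pair_big xpredT xpredT (fun k l => (pred2 i j k)%:R)) /=.
under eq_bigr => k _ do rewrite sumr_const.
rewrite sumrMnl -[leLHS]mulr_natr ler_wpM2r ?ler0n // -natr_sum ler_nat.
by rewrite sum_indicator card2; case: (i != j).
Qed.

(** Only overlapping index pairs contribute, and [count_overlap] bounds their
    number: for a given pair, at most four pairs have both indices in common
    with it, and at most [4 #|I|] have one. *)
Lemma variance_pair_count :
  mean (fun f => (pair_count f - npairs * density) ^+ 2) <=
    npairs * density * (4 + 4 * #|I|%:R * (b%:R / n)).
Proof.
have q0 := density_ge0; have N0 : 0 <= npairs by rewrite ler0n.
have bn0 : 0 <= b%:R / n by rewrite divr_ge0 ?ler0n.
set mu := npairs * density.
have -> : mean (fun f => (pair_count f - mu) ^+ 2) =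
    mean (fun f => pair_count f ^+ 2) - mu ^+ 2.
  have -> : mean (fun f => (pair_count f - mu) ^+ 2) =
      mean (fun f => pair_count f ^+ 2 + ((- 2 * mu) * pair_count f + mu ^+ 2)).
    by apply: eq_mean => f; ring.
  rewrite meanD meanD meanZ mean_pair_count mean_cst ?card_samples_gt0 //.
  by rewrite /mu; ring.
rewrite lerBlDl.
have -> : mean (fun f => pair_count f ^+ 2) =
   \sum_(a : I * I | a.1 != a.2) \sum_(c : I * I | c.1 != c.2)
     mean (fun f => (near (f a.1) (f a.2))%:R * (near (f c.1) (f c.2))%:R).
  under [RHS]eq_bigr => a _ do rewrite -mean_sum.
  rewrite -mean_sum; apply: eq_mean => f.
  by rewrite expr2 /pair_count mulr_suml; under eq_bigr do rewrite mulr_sumr.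
pose B := npairs * (density * density) +
  density * (4 + b%:R / n * (4 * #|I|%:R)).
apply: (@le_trans _ _ (\sum_(a : I * I | a.1 != a.2) B)); last first.
  by rewrite sumr_const -[_ *+ _]mulr_natl -/npairs /B /mu; lra.
apply: ler_sum => a aP.
apply: le_trans; first by apply: ler_sum => c cP; exact: mean_near2 aP cP.
rewrite big_split /= sumr_const -[X in X + _]mulr_natl -/npairs lerD2l.
rewrite -mulr_sumr ler_wpM2l // big_split /= -mulr_sumr lerD ?ler_wpM2l //.
- rewrite big_mkcond /=.
  apply: (@le_trans _ _ (\sum_(c : I * I)
     ((pred2 a.1 a.2 c.1)%:R * (pred2 a.1 a.2 c.2)%:R))).
    apply: ler_sum => c _; rewrite -natrM mulnb.
    by case: ifP => // _; rewrite ler0n.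
  rewrite -(pair_big xpredT xpredT 
    (fun k l => (pred2 a.1 a.2 k)%:R * (pred2 a.1 a.2 l)%:R)) /=.
  rewrite -big_distrlr /=.
  have le2 : \sum_(i : I) (pred2 a.1 a.2 i)%:R <= 2 :> R.
    rewrite -natr_sum ler_nat.
    by rewrite sum_indicator card2; case: (a.1 != a.2).
  have ge0 : 0 <= \sum_(i : I) (pred2 a.1 a.2 i)%:R :> R.
    by apply: sumr_ge0 => i _.
  by move: le2 ge0; set z := (\sum_i _); nra.
- rewrite big_split /=.
  have h1 := count_overlap a.1 a.2.
  have h2 : \sum_(c : I * I) (pred2 a.1 a.2 c.2)%:R <= 2 * #|I|%:R :> R.
    have swapK : involutive (fun c : I * I => (c.2, c.1)) by case.
    rewrite (reindex_inj (inv_inj swapK)) /=.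
    exact: h1.
  have le_cond (g : I * I -> bool) :
     \sum_(c : I * I | c.1 != c.2) (g c)%:R <= \sum_(c : I * I) (g c)%:R :> R.
    by rewrite big_mkcond ler_sum // => c _; case: ifP => // _; rewrite ler0n.
  have := le_cond (fun c => pred2 a.1 a.2 c.1).
  by have := le_cond (fun c => pred2 a.1 a.2 c.2); lra.
Qed.

Variables (D : V -> V -> {set V}) (c : nat).
Hypothesis D_c : forall x y, near x y -> (#|D x y| <= c)%N.

Definition hit_count f : R :=
  \sum_(a : I * I | a.1 != a.2) \sum_(l | l \notin pred2 a.1 a.2)
    (near (f a.1) (f a.2) && (f l \in D (f a.1) (f a.2)))%:R.

Lemma mean_hit_count :
  mean hit_count <= npairs * density * (#|I|%:R * (c%:R / n)).
Proof.
have q0 := density_ge0.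
have cn0 : 0 <= c%:R / n by rewrite divr_ge0 ?ler0n.
rewrite mean_sum.
apply: (@le_trans _ _ (\sum_(a : I * I | a.1 != a.2)
    (density * (#|I|%:R * (c%:R / n))))); last first.
  by rewrite sumr_const -[_ *+ _]mulr_natl -/npairs mulrA.
apply: ler_sum => -[i j] /= ij; rewrite mean_sum.
apply: (@le_trans _ _ (\sum_(l : I) (density * (c%:R / n)))); last first.
  by rewrite sumr_const -[_ *+ _]mulr_natl mulrCA.
rewrite big_mkcond ler_sum // => l _; case: ifP => [|_]; last exact: mulr_ge0.
rewrite inE negb_or => /andP[li lj].
rewrite (mean_resample V0 l) -(mean_near_pair ij) mulrC -meanZ.
apply: ler_mean => f.
under eq_mean => x do rewrite !resampleE ![_ == l]eq_sym
  (negPf li) (negPf lj) eqxx.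
case: (boolP (near _ _)) => [/D_c le_c|_] /=; last first.
  by rewrite mean_cst // mulr0.
rewrite mulr1 /mean -natr_sum sum_indicator.
by rewrite ler_pM2r ?invr_gt0 ?ltr0n // ler_nat.
Qed.

End Moments.

(** * Distinct representatives *)

Section Greedy.
Local Open Scope nat_scope.

(** Distinct representatives are chosen in the order of increasing [g]: when
    the turn of [p] comes, only representatives of elements with smaller or
    equal [g] are taken, fewer than [#|C p|]. The point [x0] is a default value for
    the function [c] outside [Q]. *)
Lemma greedy_sdr (P V : finType) (x0 : V) (C : P -> {set V}) (g : P -> nat)
    (Q : {set P}) :
  {in Q, forall p, #|[set q in Q | g q <= g p]| <= #|C p|} ->
  exists2 c : P -> V, {in Q &, injective c} & {in Q, forall p, c p \in C p}.
Proof.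
have [m] := ubnP #|Q|; elim: m Q => // m IHm Q ltQm HQ.
have [->|[p0 p0Q]] := set_0Vmem Q.
  by exists (fun=> x0) => p; rewrite inE.
(* The element that is served last. *)
case: (@arg_maxnP _ p0 [in Q] g p0Q) => p /= pQ maxp.
have sub : Q :\ p \subset Q by apply: subD1set.
have [||c injc cC] := IHm (Q :\ p).
- by move: ltQm; rewrite (cardsD1 p Q) pQ.
- move=> q /(subsetP sub) qQ; apply: leq_trans (HQ q qQ).
  apply/subset_leq_card/subsetP => r; rewrite !inE.
  by case/andP => /andP[_ ->] ->.
have [z zC zN] : exists2 z, z \in C p & z \notin c @: (Q :\ p).
  apply/subsetPn; apply/negP.
  move/subset_leq_card; apply/negP; rewrite -ltnNge.
  apply: leq_ltn_trans (leq_imset_card _ _) _.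
  apply: leq_trans (HQ p pQ).
  rewrite (_ : [set q in Q | _] = Q) ?[leqRHS](cardsD1 p) ?pQ //.
  by apply/setP => q; rewrite !inE; case: (boolP (q \in Q)) => //= /maxp.
exists (fun q => if q == p then z else c q).
  move=> q r qQ rQ /=.
  have in_im s : s \in Q -> s != p -> c s \in c @: (Q :\ p).
    by move=> sQ sp; rewrite imset_f // !inE sp.
  case: (eqVneq q p) => [->|qp]; case: (eqVneq r p) => [->|rp] //.
  - by move=> zE; move: zN; rewrite zE in_im.
  - by move=> zE; move: zN; rewrite -zE in_im.
  - by apply: injc; rewrite !inE ?qp ?rp.
move=> q qQ; case: (eqVneq q p) => [->|qp] //.
by apply: cC; rewrite !inE qp.
Qed.

End Greedy.

(** * Near vertices in a tournament *)

Section Tournament.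
Local Open Scope nat_scope.
Variables (V : finType) (e : rel V).
Hypothesis e_tour : tournament e.

(** Apart from [y] itself, these are the middle vertices of the paths of length
    two from [x] to [y]. Keeping [y] when [x] beats it makes [#|outdiff x y|]
    and [#|outdiff y x|] compare exactly as the out-degrees do, without an error
    of one. *)
Definition outdiff (x y : V) : {set V} := [set w | e x w && ~~ e y w].

Definition near t : rel V :=
  fun x y => (#|outdiff x y| < t) && (#|outdiff y x| < t).

Lemma near_sym t : symmetric (near t).
Proof. by move=> x y; rewrite /near andbC. Qed.

Lemma near_refl t x : 0 < t -> near t x x.
Proof.
move=> t0; suff -> : near t x x = (#|set0 : {set V}| < t) by rewrite cards0.
rewrite /near andbb; congr (_ < _); apply: eq_card => w.
by rewrite !inE andbN.
Qed.

Lemma near_mono s t x y : s <= t -> near s x y -> near t x y.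
Proof.
by move=> st /andP[h1 h2]; rewrite /near (leq_trans h1 st) (leq_trans h2 st).
Qed.

Lemma tourN x y : x != y -> e x y = ~~ e y x.
Proof. by move=> /(proj2 e_tour); case: (e x y); case: (e y x). Qed.

(** Of the [#|B| ^ 2] ordered pairs, those off the diagonal come in twos, one of
    which is an edge. *)
Lemma sum_edges_in (B : {set V}) :
  (\sum_(y in B) #|[set z in B | e y z]|).*2 + #|B| = #|B| ^ 2.
Proof.
have cardE y : #|[set z in B | e y z]| = \sum_(z in B) e y z.
  rewrite -sum1_card big_mkcond [RHS]big_mkcond; apply: eq_bigr => z _.
  by rewrite inE; case: (z \in B); case: (e y z).
under eq_bigr => y _ do rewrite cardE.
rewrite -addnn {2}exchange_big /= -big_split /=.
have -> : #|B| ^ 2 = \sum_(y in B) \sum_(z in B) 1.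
  by rewrite sum_nat_const sum1_card.
rewrite -sum1_card -big_split; apply: eq_bigr => y yB /=.
rewrite -big_split [RHS](bigD1 y) //= (bigD1 y) //= (proj1 e_tour) addnC.
congr (_ + _); apply: eq_bigr => z /andP[_ zy].
by rewrite (tourN zy); case: (e y z).
Qed.

(** For [y] near [x] and beaten by [x], the vertices near [x] and beaten by [x]
    but not by [y] all belong to [outdiff x y], so there are fewer than [t] of
    them; averaging over [y] shows that [x] beats at most [2 t] near vertices.
    For the other near vertices, which include [x] itself, the same argument
    applies to [outdiff y x] and the vertices beaten by [y]. *)
Lemma card_near t x : #|near t x| <= 4 * t.
Proof.
have [->|t0] := posnP t.
  by rewrite eq_card0 // => y; rewrite unfold_in /near ltn0.
pose B1 := [set y | near t x y && e x y].
pose B2 := [set y | near t x y && ~~ e x y].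
have -> : #|near t x| = #|B1| + #|B2|.
  rewrite -[LHS]cardsE -(cardsID [set y | e x y]); congr (_ + _).
    by apply: eq_card => y; rewrite !inE.
  by apply: eq_card => y; rewrite !inE andbC.
have b2 : #|B2| ^ 2 <= (#|B2| * t.-1).*2 + #|B2|.
  rewrite -sum_edges_in leq_add2r leq_double -sum_nat_const leq_sum // => y.
  rewrite inE => /andP[/andP[_ xy] xNy].
  rewrite -ltnS prednK //; apply: leq_ltn_trans xy.
  apply/subset_leq_card/subsetP => z; rewrite !inE.
  by move=> /andP[/andP[_ ->] ->].
have b1 : #|B1| ^ 2 <= (#|B1| * t.-1).*2.
  have H : \sum_(y in B1) (#|[set z in B1 | e y z]| + #|outdiff x y|) >= 
    #|B1| * #|B1|.
    rewrite -sum_nat_const leq_sum // => y yB.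
    rewrite -(cardsID [set z | e y z] B1) leq_add //.
      by apply/eq_leq/eq_card => z; rewrite !inE.
    apply/subset_leq_card/subsetP => z; rewrite !inE.
    by move=> /andP[-> /andP[_ ->]].
  rewrite big_split in H.
  have H2 : \sum_(y in B1) #|outdiff x y| <= #|B1| * t.-1.
    rewrite -sum_nat_const leq_sum // => y; rewrite inE => /andP[/andP[xy _] _].
    by rewrite -ltnS prednK.
  have := sum_edges_in B1; rewrite /= in H; nia.
have cancel b c : b ^ 2 <= b * c -> b <= c.
  by case: b => // b; rewrite -mulnn leq_pmul2l.
have {}b1 : #|B1| <= 2 * t.-1 by apply: cancel; lia.
have {}b2 : #|B2| <= 2 * t.-1 + 1 by apply: cancel; lia.
lia.
Qed.

(** The two sets complement the same common out-neighbourhood. *)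
Lemma outdiff_deg x y : #|e y| <= #|e x| -> #|outdiff y x| <= #|outdiff x y|.
Proof.
have split (u v : V) : #|e u| = #|[set w | e u w && e v w]| + #|outdiff u v|.
  rewrite -[LHS]cardsE -(cardsID [set w | e v w]); congr (_ + _).
    by apply: eq_card => w; rewrite !inE.
  by apply: eq_card => w; rewrite !inE andbC.
rewrite (split x y) (split y x).
rewrite (_ : [set w | e y w && e x w] = [set w | e x w && e y w]) ?leq_add2l //.
by apply/setP => w; rewrite !inE andbC.
Qed.

Lemma near_deg t x y : #|e y| <= #|e x| -> near t x y = (#|outdiff x y| < t).
Proof.
move=> /outdiff_deg le_yx; rewrite /near andb_idr // => lt_t.
exact: leq_ltn_trans lt_t.
Qed.

(** The middle vertices come from [greedy_sdr], applied to the sets of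
    candidates outside the branch vertices, ordered by their size before this
    removal. *)
Lemma contains_subdiv k (v : 'I_k -> V) :
  injective v ->
  (forall p : 'I_k * 'I_k, p.1 < p.2 ->
    #|[set q : 'I_k * 'I_k | (q.1 < q.2) &&
        (#|outdiff (v q.1) (v q.2)| <= #|outdiff (v p.1) (v p.2)|)]|
    <= #|outdiff (v p.1) (v p.2) :\: v @: 'I_k|) ->
  contains e (subdiv_edge (transitive_tournament k)).
Proof.
move=> injv Hv; case: k => [|k] in v injv Hv *.
  have noW (w : subdiv_vertex (transitive_tournament 0)) : False.
    by case: w => [[]|[[[]]]].
  by exists (fun w => match noW w with end); split=> [w|w]; case: (noW w).
pose g (p : 'I_k.+1 * 'I_k.+1) := #|outdiff (v p.1) (v p.2)|.
pose C (p : 'I_k.+1 * 'I_k.+1) := outdiff (v p.1) (v p.2) :\: v @: 'I_k.+1.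
pose Q := [set p : 'I_k.+1 * 'I_k.+1 | p.1 < p.2].
have [|c injc cC] := @greedy_sdr _ _ (v ord0) C g Q.
  move=> p; rewrite inE => /Hv; apply: leq_trans.
  by apply/subset_leq_card/subsetP => q; rewrite !inE.
pose mid := {p : 'I_k.+1 * 'I_k.+1 | transitive_tournament k.+1 p.1 p.2}.
have inQ (w : mid) : val w \in Q.
  by rewrite inE; apply: valP w.
exists (fun w : subdiv_vertex (transitive_tournament k.+1) =>
  match w with inl i => v i | inr p => c (val p) end); split.
  have ne i (w : mid) : v i <> c (val w) :> V.
    move=> vE; have := cC _ (inQ w); rewrite -vE /C inE imset_f //.
  move=> [i|p] [j|q].
  - by move/injv->.
  - by move/ne.
  - by move/esym/ne.
  - by move=> cpq; congr inr; apply/val_inj/injc; rewrite ?inQ.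
move=> [i|p] [j|q] //= /eqP vE.
  by have := cC _ (inQ q); rewrite !inE -vE => /andP[_ /andP[]].
have := cC _ (inQ p); rewrite !inE -vE => /andP[nv /andP[_]].
rewrite -tourN //; apply: contra nv => /eqP->; exact: imset_f.
Qed.

End Tournament.

(** * From a sample to a subdivision *)

Section Selection.
Local Open Scope nat_scope.

Lemma sorted_choice (A : finType) (S : {set A}) (d : A -> nat) k :
  k <= #|S| ->
  exists v : 'I_k -> A,
    [/\ injective v, forall i, v i \in S
      & forall i j : 'I_k, i < j -> d (v j) <= d (v i)].
Proof.
move=> kS; case: k => [|k] in kS *.
  by exists (fun i : 'I_0 => match notF (ltn_ord i) with end);
    split=> [[]|[]|[]].
have /card_gt0P[x0 _] : 0 < #|S| by apply: leq_trans kS.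
pose le := relpre d geq.
pose s := sort le (enum S).
have size_s : size s = #|S| by rewrite size_sort -cardE.
have lt_s (i : 'I_k.+1) : i < size s by rewrite size_s (leq_trans (ltn_ord i)).
exists (fun i => nth x0 s i); split=> [i j /eqP|i|i j ij].
- by rewrite nth_uniq ?lt_s // ?sort_uniq ?enum_uniq // => /eqP/val_inj.
- by rewrite -mem_enum -(mem_sort le) mem_nth.
- have le_tr : transitive le by move=> x y z /= yx xz; apply: leq_trans xz yx.
  have : sorted le s by apply: sort_sorted => x y; apply: leq_total.
  by move/(sorted_ltn_nth le_tr x0)/(_ i j); rewrite !inE !lt_s; apply.
Qed.

Variables (V I : finType) (e : rel V).
Hypothesis e_tour : tournament e.
Variable f : {ffun I -> V}.

Local Notation outdiff := (outdiff e).
Local Notation near := (near e).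

Definition near_pairs t : {set I * I} :=
  [set a | (a.1 != a.2) && near t (f a.1) (f a.2)].

Definition hits (a : I * I) : {set I} :=
  [set l | (l \notin pred2 a.1 a.2) && (f l \in outdiff (f a.1) (f a.2))].

Definition spoiled L h : {set I * I} :=
  [set a in near_pairs L | h <= #|hits a|].

(** The first index of every pair that is near at level [T], or spoiled, is
    discarded, and the [k] branch vertices are taken among the other indices.
    For a pair of branch vertices with [d] candidates, [d] is at least [T], and
    the branch vertices occupy at most [h] candidates when the pair is subject
    to the spoiling condition ([d < L]), and trivially at most [k] otherwise.
    The factor [2] appears because [near_pairs] contains every pair in both
    orders. *)
Lemma contains_of_sample k T L h :
  0 < T -> 0 < h ->
  #|near_pairs T| + #|spoiled L h| + k <= #|I| ->
  (forall d, T <= d -> minn #|near_pairs d.+1| (k ^ 2) <=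
    2 * (d - (if d < L then h else k))) ->
  contains e (subdiv_edge (transitive_tournament k)).
Proof.
move=> T0 h0 le_del le_cnt.
pose bad := [set a.1 | a in near_pairs T :|: spoiled L h].
have k_good : k <= #|~: bad|.
  have : #|bad| <= #|near_pairs T| + #|spoiled L h|.
    by apply: leq_trans (leq_imset_card _ _) _; rewrite cardsU leq_subr.
  by have := cardsC bad; rewrite -cardsT cardsT; lia.
have [v [injv v_good v_deg]] := sorted_choice (fun i => #|e (f i)|) k_good.
have ok i j : i != j -> (v i, v j) \notin near_pairs T :|: spoiled L h.
  move=> ij; apply: contraL (v_good i) => ij_bad.
  by rewrite inE negbK; apply/imsetP; exists (v i, v j).
have far i j : i != j -> ~~ near T (f (v i)) (f (v j)).
  move=> ij; have := ok _ _ ij; rewrite !inE negb_or => /andP[+ _].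
  by rewrite /= (inj_eq injv) ij.
pose w i := f (v i).
have injw : injective w.
  move=> i j wij; apply: contraTeq isT => /far.
  by rewrite [f (v i)]wij near_refl.
apply: (@contains_subdiv _ _ e_tour _ w injw) => p ltp.
set d := #|outdiff (w p.1) (w p.2)|.
have nep (q : 'I_k * 'I_k) : q.1 < q.2 -> q.1 != q.2.
  by rewrite neq_ltn => ->.
have nearE t (q : 'I_k * 'I_k) : q.1 < q.2 ->
    near t (w q.1) (w q.2) = (#|outdiff (w q.1) (w q.2)| < t).
  by move=> ltq; rewrite near_deg // v_deg.
have Td : T <= d by rewrite leqNgt -nearE // far // nep.
have loss : #|outdiff (w p.1) (w p.2) :&: w @: 'I_k| <=
    (if d < L then h else k).
  case: ifPn => [dL|_]; last first.
    apply: leq_trans (subset_leq_card (subsetIr _ _)) _.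
    by apply: leq_trans (leq_imset_card _ _) _; rewrite card_ord.
  have ne : v p.1 != v p.2 by rewrite (inj_eq injv) nep.
  have hit_lt : #|hits (v p.1, v p.2)| < h.
    have := ok _ _ (nep _ ltp); rewrite inE negb_or => /andP[_].
    by rewrite !inE /= ne /= nearE // -/d dL /= -ltnNge.
  (* The branch vertex [w p.2] may itself lie in the set, hence the [< h]. *)
  apply: leq_trans hit_lt.
  apply: (@leq_trans #|w p.2 |: f @: hits (v p.1, v p.2)|); last first.
    apply: leq_trans (leq_card_setU _ _) _; rewrite cards1 add1n ltnS.
    exact: leq_imset_card.
  apply/subset_leq_card/subsetP => z.
  rewrite in_setI => /andP[zD /imsetP[i _ zi]].
  rewrite inE; case: (eqVneq i p.2) => [ip|ip2]; first by rewrite zi ip set11.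
  case: (eqVneq i p.1) => [ip|ip1].
    by move: zD; rewrite zi ip [_ \in outdiff _ _]inE (proj1 e_tour).
  apply/orP; right; rewrite zi; apply: imset_f.
  rewrite inE /= [v i \in _]inE /= !(inj_eq injv).
  by rewrite negb_or ip1 ip2 /= -[f (v i)]zi.
(* Both orders of each pair occur in [near_pairs]. *)
pose Q := [set q : 'I_k * 'I_k | (q.1 < q.2) &&
   (#|outdiff (w q.1) (w q.2)| <= d)].
pose swap (q : 'I_k * 'I_k) := (q.2, q.1).
have swapK : involutive swap by case.
have cardW : #|Q :|: swap @: Q| = 2 * #|Q|.
  rewrite cardsU (card_imset _ (inv_inj swapK)).
  rewrite (_ : Q :&: _ = set0) ?cards0; first by lia.
  apply/setP => q; rewrite !inE; apply/negP.
  case/andP => /andP[lt1 _] /imsetP[q']; rewrite inE => /andP[lt2 _] qE.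
  by move: lt1; rewrite qE /=; lia.
have Q2 : 2 * #|Q| <= minn #|near_pairs d.+1| (k ^ 2).
  rewrite -cardW leq_min; apply/andP; split; last first.
    by apply: leq_trans (max_card _) _; rewrite card_prod card_ord mulnn.
  pose phi (q : 'I_k * 'I_k) := (v q.1, v q.2).
  have injphi : injective phi.
    by move=> [i j] [i' j'] [/injv-> /injv->].
  rewrite -(card_imset _ injphi); apply/subset_leq_card/subsetP => a.
  case/imsetP => q qW ->; rewrite inE /= (inj_eq injv).
  move: qW; rewrite inE => /orP[|/imsetP[q' + ->]]; rewrite inE => /andP[ltq].
    by rewrite nep //= nearE.
  by rewrite eq_sym nep //= near_sym nearE.
have := le_cnt d Td; have := cardsID (w @: 'I_k) (outdiff (w p.1) (w p.2)).
by rewrite -/d -/Q; lia.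
Qed.

End Selection.

Section Counts.
Variables (R : realFieldType) (V I : finType) (e : rel V) (f : {ffun I -> V}).

Lemma pair_countE t : pair_count R (near e t) f = #|near_pairs e f t|%:R.
Proof.
rewrite /pair_count -sum1_card natr_sum big_mkcond [RHS]big_mkcond.
apply: eq_bigr => a _.
by rewrite inE; case: (a.1 != a.2); case: (near _ _ _ _).
Qed.

Lemma spoiled_le_hit_count L h :
  (h * #|spoiled e f L h|)%:R <= hit_count R (near e L) (outdiff e) f.
Proof.
rewrite /hit_count mulnC -sum_nat_const natr_sum big_mkcond [leRHS]big_mkcond.
apply: ler_sum => a _; rewrite !inE -andbA.
case: (a.1 != a.2) => //=; case: (near _ _ _ _) => /=; last first.
  by apply: sumr_ge0.
case: leqP => [le_h|_]; last exact: sumr_ge0.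
rewrite -natr_sum ler_nat; apply: leq_trans le_h _; apply: eq_leq.
rewrite -sum1_card big_mkcond [RHS]big_mkcond; apply: eq_bigr => l _.
by rewrite inE; case: (l \notin _).
Qed.
End Counts.

(** * Numerical parameters *)

Section Numbers.
Local Open Scope nat_scope.

Lemma exists_root p d : 0 < p -> exists j, j ^ p <= d < j.+1 ^ p.
Proof.
move=> p0; have ex0 : exists j, j ^ p <= d by exists 0; rewrite exp0n.
have bounded j : j ^ p <= d -> j <= d.
  by apply: leq_trans; case: j => // j; rewrite -{1}[j.+1]expn1 leq_pexp2l.
have [j jd maxj] := ex_maxnP ex0 bounded; exists j; rewrite jd ltnNge /=.
by apply/negP => /maxj; rewrite ltnn.
Qed.

(** The fourth powers are dense enough to serve as levels: from [16 m] on,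
    rounding up to the next one costs a factor at most [1 + 1 / m]. *)
Lemma next_level m j : 16 * m <= j -> 0 < m ->
  m * j.+1 ^ 4 <= m.+1 * j ^ 4.
Proof.
move=> mj m0.
suff : 16 * (m * (4 * j ^ 3 + 6 * j ^ 2 + 4 * j + 1)) <= 16 * j ^ 4 by nia.
rewrite mulnA; apply: (@leq_trans (j * (4 * j ^ 3 + 6 * j ^ 2 + 4 * j + 1))).
  by rewrite leq_mul2r mj orbT.
have j0 : 0 < j by lia.
nia.
Qed.

Lemma leq_double_divn a b : 0 < b -> b <= a -> a <= 2 * b * (a %/ b).
Proof.
move=> b0 ba; have q0 : 0 < a %/ b by rewrite divn_gt0.
apply: leq_trans (ltnW (ltn_ceil a b0)) _.
by rewrite -mulnA mulnCA mulnC mul2n -addnn leq_mul2l -add1n leq_add2r q0 orbT.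
Qed.

(** The sample has [spare m k] more indices than the [k] that are needed, to be
    lost to discarded pairs. *)
Definition spare m k := k %/ m.

(** Pairs with fewer candidates than this are discarded; in both orders, there
    are at most about [2 * near_cut m k] of them in the sample, hence the
    fraction of [spare]. *)
Definition near_cut m k := spare m k %/ 12.

(** What a usable pair may lose to the sample: a fraction [1 / m] of the least
    number of candidates. *)
Definition hit_cut m k := near_cut m k %/ m.

Section Sizes.
Variables m k : nat.
Hypotheses (m_ge : 100 <= m) (k_ge : m ^ 12 <= k).

Local Notation r := (spare m k).
Local Notation T := (near_cut m k).
Local Notation h := (hit_cut m k).

Let k_ge10 : m ^ 10 <= k.
Proof. by apply: leq_trans k_ge; rewrite leq_pexp2l //; lia. Qed.

Let m0 : 0 < m. Proof. exact: leq_trans m_ge. Qed.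

Let le12m : 12 * m <= m ^ 2.
Proof. by rewrite leq_mul2r (leq_trans _ m_ge) ?orbT. Qed.

Lemma near_cut_large : (16 * m).+1 ^ 4 <= T.
Proof.
have lt16 : (16 * m).+1 <= m ^ 2.
  apply: (@leq_trans (17 * m)); first by rewrite [leqRHS]mulSn -add1n leq_add2r.
  by rewrite leq_mul2r (leq_trans _ m_ge) ?orbT.
apply: (@leq_trans (m ^ 8)); first by rewrite (expnM m 2 4) leq_exp2r.
rewrite /near_cut /spare leq_divRL // leq_divRL //; apply: leq_trans k_ge10.
by rewrite -mulnA (expnD m 8 2) leq_mul2l le12m orbT.
Qed.

Lemma hit_cut_large : m ^ 7 <= h.
Proof.
rewrite /hit_cut /near_cut /spare !leq_divRL //; apply: leq_trans k_ge10.
have -> : m ^ 7 * m * 12 * m = m ^ 7 * (m * (12 * m)) by rewrite !mulnA.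
by rewrite (expnD m 7 3) leq_mul2l expnS leq_mul2l le12m !orbT.
Qed.

Lemma le_spare : k <= 2 * m * r.
Proof.
apply: leq_double_divn => //; apply: leq_trans k_ge10.
by rewrite -{1}[m]expn1 leq_pexp2l.
Qed.

Lemma le_near_cut : k <= 48 * m * T.
Proof.
apply: leq_trans le_spare _.
have -> : 48 * m * T = 2 * m * (2 * 12 * T) by rewrite (mulnACA 2) mulnA.
rewrite leq_mul2l; apply/orP; right; apply: leq_double_divn => //.
have T0 : 0 < T by apply: leq_trans near_cut_large; rewrite expn_gt0.
by rewrite -(@divn_gt0 12).
Qed.

(** By [mean_hit_count], the average number of hits is at most [8 m ^ 2 k], and
    more than [r / 2] spoiled pairs make more than [h * r / 2] of them. *)
Lemma spoil_budget : 32 * m ^ 2 * k < h * r.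
Proof.
have lt64 : 64 * m ^ 3 < m ^ 7.
  rewrite (expnD m 4 3) ltn_mul2r expn_gt0 m0 /=.
  apply: (@leq_trans m); first exact: leq_trans m_ge.
  by rewrite -{1}[m]expn1 leq_pexp2l.
have r0 : 0 < r.
  by rewrite /spare divn_gt0 // (leq_trans _ k_ge10) // -{1}[m]expn1 leq_pexp2l.
apply: (@leq_ltn_trans (64 * m ^ 3 * r)).
  have -> : 64 * m ^ 3 * r = 32 * m ^ 2 * (2 * m * r).
    by rewrite (expnD m 2 1); ring.
  by rewrite leq_mul2l le_spare orbT.
by rewrite ltn_mul2r r0 (leq_trans lt64 hit_cut_large).
Qed.

(** The levels needed are the fourth powers [j.+1 ^ 4] with [j <= s]; as the
    failure probability of each is of order [m ^ 3 / k], this makes their sum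
    small. *)
Lemma few_levels s : s ^ 2 <= k < s.+1 ^ 2 -> s.+1 * m ^ 5 < k.
Proof.
case/andP => s_le s_gt.
have s_ge : m * m ^ 5 <= s.
  rewrite -expnS -ltnS -(@ltn_exp2r _ _ 2) //; apply: leq_ltn_trans s_gt.
  by rewrite -expnM.
have c0 : 0 < m ^ 5 by rewrite expn_gt0 m0.
have s0 : 0 < s by apply: leq_trans s_ge; rewrite muln_gt0 m0.
apply: leq_trans s_le.
apply: (@leq_ltn_trans (s * (2 * m ^ 5))).
  by rewrite mulnA leq_mul2r muln2 -addnn -(addn1 s) leq_add2l s0 orbT.
rewrite -mulnn ltn_mul2l s0 (leq_trans _ s_ge) // ltn_mul2r c0.
exact: leq_trans m_ge.
Qed.

End Sizes.
End Numbers.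

(** * Existence of a good sample *)

(** Here [M], [kk], [K] and [n] stand for [m], [k], the number of indices and
    the number of vertices, [t] is a level, and [x] the expected number of
    ordered near pairs. *)
Section Estimates.
Variables (R : realFieldType) (M kk K n t x : R).
Hypotheses (M_ge : 100 <= M) (kk_gt0 : 0 < kk) (K_ge0 : 0 <= K)
  (K_le : K * M <= kk * (M + 1)) (n_ge : 2 * (M + 16) * kk ^+ 2 <= M * n)
  (t_gt0 : 0 < t) (x_ge0 : 0 <= x) (x_le : x <= K ^+ 2 * (4 * t / n)).

Let M_gt0 : 0 < M. Proof. by move: M_ge; lra. Qed.
Let n_gt0 : 0 < n.
Proof.
rewrite -(pmulr_rgt0 _ M_gt0); apply: lt_le_trans n_ge.
by rewrite mulr_gt0 ?exprn_gt0 // mulr_gt0 // addr_gt0.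
Qed.

(** The expected number of unordered near pairs is at most
    [t (1 + 1/M) ^ 2 / (1 + 16/M)], a fraction of [t] bounded away from [1]. *)
Lemma expect_le : M * (M + 16) * x <= 2 * (M + 1) ^+ 2 * t.
Proof.
have xn : x * n <= 4 * K ^+ 2 * t.
  by rewrite -ler_pdivlMr //; apply: le_trans x_le _; lra.
have KM2 : (K * M) ^+ 2 <= (kk * (M + 1)) ^+ 2.
  by rewrite lerXn2r // nnegrE ?mulr_ge0 ?addr_ge0 // ltW.
have kk2 : 0 < kk ^+ 2 by rewrite exprn_gt0.
rewrite -(ler_pM2r kk2) -(ler_pM2l (ltr0n R 2)).
apply: (@le_trans _ _ (M * (M * n) * x)).
  have := ler_wpM2l (mulr_ge0 (ltW M_gt0) x_ge0) n_ge.
  lra.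
apply: (@le_trans _ _ (M ^+ 2 * (4 * K ^+ 2 * t))).
  by have := ler_wpM2l (sqr_ge0 M) xn; lra.
by have := ler_wpM2r (ltW t_gt0) KM2; lra.
Qed.

Lemma expect_le8 : x <= 8 * t.
Proof.
have c_gt0 : 0 < M * (M + 16) by rewrite mulr_gt0 ?addr_gt0.
rewrite -(ler_pM2l c_gt0); apply: le_trans expect_le _.
have le4 : (M + 1) ^+ 2 <= M * (M + 16) * 4.
  by have := ler_wpM2l (ltW M_gt0) M_ge; move: M_ge; lra.
by have := ler_wpM2r (ltW t_gt0) le4; lra.
Qed.

Lemma ratio_le : K / n <= kk^-1.
Proof.
rewrite ler_pdivrMr // mulrC ler_pdivlMr // -(ler_pM2l M_gt0).
apply: le_trans n_ge; have := ler_wpM2r (ltW kk_gt0) K_le.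
have := ler_wpM2r (sqr_ge0 kk) (ltW M_gt0); have := sqr_ge0 kk.
lra.
Qed.

(** The failure probability of a level given by Chebyshev's inequality, for a
    deviation [t / M]. *)
Lemma level_variance : kk <= 48 * M * t ->
  (M / t) ^+ 2 * (x * (4 + 4 * K * (4 * t / n))) <= 1664 * M ^+ 3 / kk.
Proof.
move=> kk_le.
have -> : 4 + 4 * K * (4 * t / n) = 4 + 16 * t * (K / n).
  by field; rewrite gt_eqF.
apply: (@le_trans _ _ ((M / t) ^+ 2 * (8 * t * (4 + 16 * t / kk)))).
  apply: ler_wpM2l; first exact: sqr_ge0.
  apply: (ler_pM x_ge0 _ expect_le8).
    by rewrite addr_ge0 ?mulr_ge0 ?invr_ge0 ?(ltW t_gt0) ?(ltW n_gt0).
  rewrite lerD2l ler_wpM2l ?ratio_le //.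
  by rewrite mulr_ge0 // ltW.
have -> : (M / t) ^+ 2 * (8 * t * (4 + 16 * t / kk)) =
          (32 * M ^+ 2 * (kk / t) + 128 * M ^+ 2) / kk.
  by field; rewrite !gt_eqF.
rewrite ler_pM2r ?invr_gt0 //.
have q : kk / t <= 48 * M by rewrite ler_pdivrMr.
have := ler_wpM2l (sqr_ge0 M) q; have := ler_wpM2l (sqr_ge0 M) M_ge.
have := exprn_ge0 3 (ltW M_gt0); lra.
Qed.
End Estimates.

Section GoodSample.
Variables (R : realFieldType) (V : finType) (e : rel V).
Hypothesis e_tour : tournament e.
Variables m k : nat.
Hypotheses (m_ge : (100 <= m)%N) (k_ge : (m ^ 12 <= k)%N)
  (n_ge : (2 * (m + 16) * k ^ 2 <= m * #|V|)%N).

Local Notation r := (spare m k).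
Local Notation T := (near_cut m k).
Local Notation h := (hit_cut m k).

(** The penalties added up are the normalized number of hits and, for each
    level, the normalized squared deviation of the number of near pairs.
    Spoiling is considered for pairs with fewer than [k * m] candidates; losing
    [k] candidates is harmless for the others. *)
Lemma exists_good_sample : exists f : {ffun 'I_(k + r) -> V},
  (2 * #|spoiled e f (k * m) h| <= r)%N /\
  forall j, (j ^ 2 <= k)%N -> (T <= j.+1 ^ 4)%N ->
    (m * (m + 16) * #|near_pairs e f (j.+1 ^ 4)|
       <= (2 * (m + 1) ^ 2 + m + 16) * j.+1 ^ 4)%N.
Proof.
have m0 : (0 < m)%N by exact: leq_trans m_ge.
have k0 : (0 < k)%N by apply: (leq_trans _ k_ge); rewrite expn_gt0 m0.
have V0 : (0 < #|V|)%N.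
  have : (0 < m * #|V|)%N.
    by apply: (leq_trans _ n_ge); rewrite !muln_gt0 k0 addn_gt0 m0.
  by rewrite muln_gt0 m0.
have T0 : (0 < T)%N.
  apply: (@leq_trans ((16 * m).+1 ^ 4)); first by rewrite expn_gt0.
  exact: near_cut_large.
have h0 : (0 < h)%N.
  apply: (@leq_trans (m ^ 7)); first by rewrite expn_gt0 m0.
  exact: hit_cut_large.
have r0 : (0 < r)%N by apply: leq_trans T0 _; apply: leq_div.
pose I := 'I_(k + r).
pose K : R := (k + r)%:R.
pose M : R := m%:R.
pose n : R := #|V|%:R.
pose expect t : R := npairs R I * density R (near e t).
have M_ge : 100 <= M by rewrite ler_nat.
have M_gt0 : 0 < M by rewrite ltr0n.
have kk_gt0 : 0 < k%:R :> R by rewrite ltr0n.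
have n_gt0 : 0 < n by rewrite ltr0n.
have K_ge0 : 0 <= K by rewrite ler0n.
have K_le : K * M <= k%:R * (M + 1).
  by rewrite /M natr1 -!natrM ler_nat mulnDl mulnS addnC leq_add2r
    leq_trunc_div.
have nR : 2 * (M + 16) * k%:R ^+ 2 <= M * n.
  by rewrite /M /n -natrD -natrX -!natrM ler_nat.
have expect_ge0 t : 0 <= expect t.
  by rewrite mulr_ge0 ?ler0n // density_ge0.
have expect_up t : expect t <= K ^+ 2 * (4 * t%:R / n).
  rewrite ler_pM ?ler0n ?density_ge0 //.
    by apply: le_trans (npairs_le R I) _; rewrite card_ord.
  by rewrite -natrM; apply: density_le => // x; apply: card_near.
have [s /[dup] s_bd /andP[s_le s_gt]] := @exists_root 2 k isT.
have levels := few_levels m_ge k_ge s_bd.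
pose t (j : 'I_s.+1) : nat := (j.+1 ^ 4)%N.
have t_gt0 j : 0 < (t j)%:R :> R by rewrite ltr0n expn_gt0.
pose Z j (f : {ffun I -> V}) : R :=
  ((M / (t j)%:R) * (pair_count R (near e (t j)) f - expect (t j))) ^+ 2.
pose Y (f : {ffun I -> V}) : R :=
  2 / (h * r)%:R * hit_count R (near e (k * m)) (outdiff e) f.
have hr0 : 0 < (h * r)%:R :> R by rewrite ltr0n muln_gt0 h0.
have hit_ge0 (f : {ffun I -> V}) :
    0 <= hit_count R (near e (k * m)) (outdiff e) f :> R.
  by apply: sumr_ge0 => a _; apply: sumr_ge0.
have meanY : mean Y < 2^-1.
  rewrite meanZ.
  have L0 : 0 < (k * m)%:R :> R by rewrite ltr0n muln_gt0 k0.
  have D_le x y : near e (k * m) x y -> (#|outdiff e x y| <= k * m)%N.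
    by case/andP => /ltnW.
  have := mean_hit_count R I V0 D_le.
  rewrite card_ord -/K -/n -/(expect _) => mean_le.
  have x8 := expect_le8 M_ge kk_gt0 K_ge0 K_le nR L0 (expect_ge0 _)
    (expect_up _).
  have rat := ratio_le M_ge kk_gt0 K_le nR.
  have hit_le : mean (@hit_count R I V (near e (k * m)) (outdiff e)) <=
      8 * M ^+ 2 * k%:R.
    have -> : 8 * M ^+ 2 * k%:R =
        8 * (k * m)%:R * ((k * m)%:R * k%:R^-1) :> R.
      by rewrite natrM /M; field; rewrite gt_eqF.
    apply: le_trans mean_le _; rewrite [K * _]mulrCA.
    apply: ler_pM => //; first by rewrite mulr_ge0 ?divr_ge0 // ltW.
    by rewrite ler_pM2l.
  rewrite mulrAC ltr_pdivrMr //.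
  have : 32 * M ^+ 2 * k%:R < (h * r)%:R.
    by rewrite /M -natrX -!natrM ltr_nat spoil_budget.
  by move: hit_le; lra.
have meanZ_le j : (T <= t j)%N -> mean (Z j) <= 1664 * M ^+ 3 / k%:R.
  move=> Tt; rewrite /Z; under eq_mean => f do rewrite exprMn.
  rewrite meanZ.
  apply: le_trans (level_variance M_ge kk_gt0 K_ge0 K_le nR (t_gt0 j)
    (expect_ge0 _) (expect_up _) _).
    rewrite ler_wpM2l ?sqr_ge0 //.
    have := variance_pair_count R I V0 (@near_sym V e (t j))
      (card_near e_tour (t j)).
    by rewrite card_ord natrM.
  rewrite -!natrM ler_nat; apply: leq_trans (le_near_cut m_ge k_ge) _.
  by rewrite leq_mul2l Tt orbT.
have [|||f [Yf Zf]] := @exists_all_lt1 R _ _ (fun j => (T <= t j)%N) Y Z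
  (card_samples_gt0 I V0).
- by move=> f; rewrite mulr_ge0 ?divr_ge0 ?(ltW hr0).
- by move=> j f; rewrite sqr_ge0.
- have sumZ : \sum_(j | (T <= t j)%N) mean (Z j) <= 2^-1.
    apply: (@le_trans _ _ (\sum_(j : 'I_s.+1) 1664 * M ^+ 3 / k%:R)).
      rewrite big_mkcond ler_sum // => j _; case: ifP => [/meanZ_le //|_].
      by rewrite divr_ge0 ?mulr_ge0 ?exprn_ge0 // ltW.
    rewrite sumr_const card_ord -[_ *+ _]mulr_natl mulrA ler_pdivrMr //.
    have : s.+1%:R * M ^+ 5 <= k%:R by rewrite /M -natrX -natrM ler_nat ltnW.
    have : 3328 * M ^+ 3 <= M ^+ 5.
      have M3 : 0 <= M ^+ 3 by rewrite exprn_ge0 // ltW.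
      have : 100 * 100 <= M * M by rewrite ler_pM.
      by move=> /(ler_wpM2l M3); move: M3; lra.
    move=> /(ler_wpM2l (ler0n R s.+1)).
    lra.
  by have := meanY; lra.
exists f; split.
  have hit_ge := spoiled_le_hit_count R e f (k * m) h.
  move: Yf; rewrite /Y mulrAC ltr_pdivrMr // mul1r => hit_lt.
  rewrite ltnW // -(ltn_pmul2l h0) -(ltr_nat R); apply: le_lt_trans hit_lt.
  by rewrite mulnCA natrM ler_pM2l.
move=> j jk Tj.
have js : (j < s.+1)%N.
  by rewrite -(@ltn_exp2r _ _ 2) //; apply: leq_ltn_trans s_gt.
have := Zf (Ordinal js) Tj; rewrite /Z pair_countE.
set tj := t _; set X := #|_| => Z_lt1.
have tj_gt0 : 0 < tj%:R :> R by exact: t_gt0.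
have X_lt : M * (X%:R - expect tj) <= tj%:R.
  rewrite -[leRHS]mul1r -ler_pdivrMr // mulrAC.
  rewrite leNgt; apply/negP => gt1; move: Z_lt1; rewrite ltNge.
  by rewrite expr2 mulr_ege1 // ltW.
have x_le := expect_le M_ge kk_gt0 K_ge0 K_le nR tj_gt0 (expect_ge0 _)
  (expect_up _).
have -> : (j.+1 ^ 4)%N = tj by [].
rewrite -/X -(ler_nat R).
move: X_lt x_le {Z_lt1 tj_gt0}; move: tj X => tj X X_lt x_le.
rewrite !(natrM, natrD) -/M.
have M16 : 0 <= M + 16 by rewrite addr_ge0 // ltW.
have := ler_wpM2l M16 X_lt; lra.
Qed.
End GoodSample.

(** * The theorem *)

(** The slack [16 / m] in the number of vertices outweighs the losses: the
    deviation and the gap between the levels around [d] in the number [X] of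
    near pairs, and the occupied candidates. *)
Lemma enough_middles (R : realFieldType) (m X t d loss : nat) : (100 <= m)%N ->
  (m * (m + 16) * X <= (2 * (m + 1) ^ 2 + m + 16) * t)%N ->
  (m * t <= m.+1 * d)%N -> (m * loss <= d)%N -> (X <= 2 * (d - loss))%N.
Proof.
move=> m_ge hX ht hl.
have le_ld : (loss <= d)%N by apply: leq_trans hl; apply: leq_pmull; lia.
pose M : R := m%:R.
have M_ge : 100 <= M by rewrite (ler_nat _ 100).
have M_gt0 : 0 < M by lra.
have {}hX : M * (M + 16) * X%:R <= (2 * (M + 1) ^+ 2 + M + 16) * t%:R.
  by move: hX; rewrite -(ler_nat R) !(natrM, natrD) -/M.
have {}ht : M * t%:R <= (M + 1) * d%:R.
  by move: ht; rewrite -(ler_nat R) !natrM -natr1.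
have {}hl : M * loss%:R <= d%:R by rewrite -natrM ler_nat.
rewrite -(ler_nat R) natrM natrB //.
have d0 : 0 <= d%:R :> R by [].
have c_gt0 : 0 < M ^+ 2 * (M + 16) by rewrite mulr_gt0 ?exprn_gt0 // addr_gt0.
rewrite -(ler_pM2l c_gt0).
have h1 := ler_wpM2l (ltW M_gt0) hX.
have c1 : 0 <= 2 * (M + 1) ^+ 2 + M + 16 by have := sqr_ge0 (M + 1); lra.
have h2 := ler_wpM2l c1 ht.
have c2 : 0 <= 2 * M * (M + 16).
  by rewrite mulr_ge0 ?addr_ge0 // ?mulr_ge0 // ltW.
have h3 := ler_wpM2l c2 hl.
have p0 : 0 <= 23 * M ^+ 2 - 55 * M - 18.
  by have := ler_wpM2l (ltW M_gt0) M_ge; lra.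
have h4 := mulr_ge0 p0 d0.
lra.
Qed.

Lemma contains_subdiv_large (R : realFieldType) (V : finType) (e : rel V)
    (m k : nat) :
  tournament e -> (100 <= m)%N -> (m ^ 12 <= k)%N ->
  (2 * (m + 16) * k ^ 2 <= m * #|V|)%N ->
  contains e (subdiv_edge (transitive_tournament k)).
Proof.
move=> e_tour m_ge k_ge n_ge.
have [f [few_spoiled few_near]] := exists_good_sample R e_tour m_ge k_ge n_ge.
set r := spare m k in f few_spoiled few_near.
set T := near_cut m k in few_near; set h := hit_cut m k in few_spoiled.
have m0 : (0 < m)%N by apply: leq_trans m_ge.
have T_ge : ((16 * m).+1 ^ 4 <= T)%N by exact: near_cut_large.
have T0 : (0 < T)%N by apply: leq_trans T_ge; rewrite expn_gt0.
have h0 : (0 < h)%N.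
  by apply: (@leq_trans (m ^ 7)); [rewrite expn_gt0 m0 | exact: hit_cut_large].
have near_le s t : (s <= t)%N -> (#|near_pairs e f s| <= #|near_pairs e f t|)%N.
  move=> st; apply/subset_leq_card/subsetP => a; rewrite !inE.
  by case/andP => -> /(near_mono st)->.
(* The number of candidates that the branch vertices may occupy. *)
pose loss d := (if d < k * m then h else k)%N.
have loss_le d : (T <= d)%N -> (m * loss d <= d)%N.
  move=> Td; rewrite /loss; case: ltnP => [_|]; last by rewrite mulnC.
  by apply: leq_trans Td; rewrite mulnC leq_trunc_div.
have level d : (T <= d)%N -> (d < k ^ 2)%N ->
    (#|near_pairs e f d.+1| <= 2 * (d - loss d))%N.
  move=> Td dk; have [j /andP[jd dj]] := @exists_root 4 d isT.
  apply: leq_trans (near_le _ _ dj) _.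
  apply: (@enough_middles R m _ (j.+1 ^ 4)) => //; last exact: loss_le.
    apply: few_near; last exact: leq_trans Td (ltnW dj).
    rewrite -(@leq_exp2r _ _ 2) // -expnM.
    exact: leq_trans jd (ltnW dk).
  apply: leq_trans (next_level _ m0) _; last by rewrite leq_mul2l jd orbT.
  rewrite -ltnS -(@leq_exp2r _ _ 4) //.
  exact: leq_trans T_ge (leq_trans Td (ltnW dj)).
have r_T : (12 * T <= r)%N by rewrite mulnC leq_trunc_div.
have r_k : (r <= k)%N by apply: leq_div.
apply: (@contains_of_sample _ _ _ e_tour f k T (k * m) h T0 h0).
  have few_T : (#|near_pairs e f T| <= 2 * T)%N.
    apply: leq_trans (near_le _ _ (leqnSn T)) _.
    apply: leq_trans (level T _ _) _ => //; last first.
      by rewrite leq_mul2l leq_subr orbT.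
    by rewrite -mulnn; nia.
  by rewrite card_ord; clear - few_T few_spoiled r_T; lia.
move=> d Td; rewrite -/(loss d); have [dk|kd] := ltnP d (k ^ 2).
  by apply: leq_trans (geq_minl _ _) (level _ Td dk).
apply: leq_trans (geq_minr _ _) _; apply: leq_trans kd _.
have loss2 : (2 * loss d <= d)%N.
  apply: leq_trans (loss_le d Td).
  by rewrite leq_mul2r (leq_trans _ m_ge) ?orbT.
by rewrite mulnBr mul2n -addnn -addnBA ?leq_addr.
Qed.

Theorem theorem1p1 (R : realType) (delta : R) (hdelta : 0 < delta) :
  exists k0 : nat, forall k : nat, (k0 <= k)%N ->
    forall (V : finType) (e : rel V), tournament e ->
      2 * (1 + delta) * k%:R ^+ 2 <= #|V|%:R :> R ->
      contains e (subdiv_edge (transitive_tournament k)).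
Proof.
pose m := maxn 100 (Num.bound (16 / delta)).
exists (m ^ 12)%N => k k_ge V e e_tour n_ge.
have m_ge : (100 <= m)%N by rewrite leq_maxl.
apply: (contains_subdiv_large R e_tour m_ge k_ge).
have m_delta : 16 <= m%:R * delta.
  rewrite -ler_pdivrMr //; apply: le_trans (ltW (archi_boundP _)) _.
    by rewrite divr_ge0 // ltW.
  by rewrite ler_nat leq_maxr.
rewrite -(ler_nat R) !(natrM, natrD).
have h1 := ler_wpM2l (ler0n R m) n_ge.
have h2 := ler_wpM2r (sqr_ge0 (k%:R : R)) m_delta.
lra.
Qed.
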